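(* If $G$ is a graph in $1$-$HNG$, then there exists a vertex $v$ of $G$ such that $G-\{v\}$ is a perfect graph.
   Context: All graphs are finite, simple, and have at least one vertex (except that $G-\{v\}$ may be empty, in which case it is regarded as perfect); induced subgraphs are taken on nonempty vertex sets. $\chi(G)$ is the chromatic number, $\theta(G)=\chi(\overline{G})$ is the clique cover number, and $G-\{v\}$ is the induced subgraph on $V(G)\setminus\{v\}$. A graph $G$ is in the class $1$-$HNG$ if every induced subgraph $H$ of $G$ (including $G$ itself) satisfies $\chi(H)+\theta(H)\ge |V(H)|$. A graph is perfect if every induced subgraph $H$ has $\chi(H)=\omega(H)$, where $\omega$ is the clique number. *)

(* Defs.v *)
From mathcomp Require Import all_boot.

Set Implicit Arguments.
Unset Strict Implicit.
Unset Printing Implicit Defensive.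

Record sgraph := SGraph {
  vertex :> finType;
  adj : rel vertex;
  adj_sym : symmetric adj;
  adj_irrefl : irreflexive adj }.

(* The vertex type is a subtype, so S may be empty; nonemptiness is required
   where induced subgraphs are quantified over. *)
Section Induced.
Variables (G : sgraph) (S : {set G}).

Definition induced_adj : rel {x : G | x \in S} :=
  fun x y => adj (val x) (val y).

Lemma induced_sym : symmetric induced_adj.
Proof. by move=> x y; apply: adj_sym. Qed.

Lemma induced_irrefl : irreflexive induced_adj.
Proof. by move=> x; apply: adj_irrefl. Qed.

Definition induced : sgraph := SGraph induced_sym induced_irrefl.
End Induced.

Section Complement.
Variable G : sgraph.

Definition compl_adj : rel G := fun x y => (x != y) && ~~ adj x y.

Lemma compl_sym : symmetric compl_adj.
Proof. by move=> x y; rewrite /compl_adj eq_sym adj_sym. Qed.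

Lemma compl_irrefl : irreflexive compl_adj.
Proof. by move=> x; rewrite /compl_adj eqxx. Qed.

Definition compl : sgraph := SGraph compl_sym compl_irrefl.
End Complement.

Definition proper_coloring (G : sgraph) (k : nat) (f : {ffun G -> 'I_k}) : bool :=
  [forall x, forall y, adj x y ==> (f x != f y)].

Definition colorable (G : sgraph) (k : nat) : bool :=
  [exists f : {ffun G -> 'I_k}, proper_coloring f].

Lemma colorable_exists (G : sgraph) : exists k, colorable G k.
Proof.
exists #|G|; apply/existsP; exists [ffun x => enum_rank x].
apply/forallP => x; apply/forallP => y; apply/implyP => xy.
rewrite !ffunE; apply: contraTneq xy => /enum_rank_inj ->.
by rewrite adj_irrefl.
Qed.

Definition chi (G : sgraph) : nat := ex_minn (colorable_exists G).

Definition theta (G : sgraph) : nat := chi (compl G).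

Definition clique (G : sgraph) (K : {set G}) : bool :=
  [forall x in K, forall y in K, (x != y) ==> adj x y].

Definition omega (G : sgraph) : nat := \max_(K : {set G} | clique K) #|K|.

(* Holds vacuously when G has no vertices. *)
Definition perfect (G : sgraph) : Prop :=
  forall S : {set G}, S != set0 -> chi (induced S) = omega (induced S).

Definition one_HNG (G : sgraph) : Prop :=
  forall S : {set G}, S != set0 ->
    #|induced S| <= chi (induced S) + theta (induced S).

Definition del_vertex (G : sgraph) (v : G) : sgraph := induced [set~ v].

(* Main.v *)
Require Import Defs.
From mathcomp Require Import all_boot zify.

Set Implicit Arguments.
Unset Strict Implicit.
Unset Printing Implicit Defensive.

(* Every induced subgraph H of G satisfies |H| <= chi(H) + theta(H); this condition is
   self-complementary.

   If G has no induced pentagon, then it is perfect. In a minimal set S with chi > omega,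
   deleting a vertex gives |S| <= alpha + omega + 1. No stable set meets all maximum
   cliques, so S is a maximum stable set I, a disjoint maximum clique K and at most one
   more vertex r. Degrees are at least omega, hence r exists and is complete to I. For k
   in K not adjacent to r, some clique of size omega avoids r and k, which gives y in I
   whose only non-neighbour in K is k. Two such k, together with their y and r, form a
   pentagon.

   All induced pentagons of G share a vertex. A finite search shows that a pentagon has
   at most two vertices outside another one, and that when it has exactly two, some
   vertex of their intersection lies in every pentagon. Otherwise any two distinct
   pentagons C, D differ in one vertex, and a neighbour of the vertex of D outside C lies
   in every pentagon. *)

(** * Perfection in the absence of pentagons *)

(* Reading a pentagon along its diagonals gives a pentagon of the complement. *)
Definition pentagram (X : Type) (s : seq X) : seq X :=
  if s is [:: a; b; c; d; f] then [:: a; c; f; b; d] else s.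

Section Relations.
Variable T : finType.
Implicit Types (e : rel T) (S I K : {set T}) (s : seq T).

Definition co_rel e : rel T := fun x y => (x != y) && ~~ e x y.

Definition kcol e k S : bool :=
  [exists f : {ffun T -> 'I_k.+1},
    [forall x in S, f x < k] &&
    [forall x in S, forall y in S, e x y ==> (f x != f y)]].

Lemma kcolP e k S :
  reflect (exists f : T -> nat, {in S, forall x, f x < k} /\
             {in S &, forall x y, e x y -> f x != f y})
          (kcol e k S).
Proof.
apply: (iffP existsP) => [[f /andP[/forall_inP fk /forall_inP fP]]|[f [fk fP]]].
  exists (fun x => val (f x)); split=> // x y xS yS exy.
  by have /forall_inP/(_ y yS)/implyP := fP x xS; apply.
have fE x : x \in S -> (inord (f x) : 'I_k.+1) = f x :> nat.
  by move=> /fk fx; rewrite inordK // ltnW.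
exists [ffun x => inord (f x)]; apply/andP; split.
  by apply/forall_inP => x xS; rewrite ffunE fE ?fk.
apply/forall_inP => x xS; apply/forall_inP => y yS; apply/implyP => exy.
by rewrite !ffunE -val_eqE /= !fE // fP.
Qed.

Lemma eq_kcol e e' k S : e =2 e' -> kcol e k S = kcol e' k S.
Proof.
move=> ee; apply/kcolP/kcolP => -[f [fk fP]]; exists f; split=> // x y xS yS;
  by [rewrite -ee; apply: fP | rewrite ee; apply: fP].
Qed.

Definition clq e K : bool := [forall x in K, forall y in K, (x != y) ==> e x y].

Lemma clqP e K :
  reflect {in K &, forall x y, x != y -> e x y} (clq e K).
Proof.
apply: (iffP forall_inP) => [h x y xK yK|h x xK].
  by apply/implyP; have /forall_inP/(_ y yK) := h x xK.
by apply/forall_inP => y yK; apply/implyP; apply: h.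
Qed.

(* The clique number of the subgraph induced on [S]; for [co_rel e] it is the
   stability number. *)
Definition om e S := \max_(K : {set T} | (K \subset S) && clq e K) #|K|.

Lemma clq0 e : clq e set0.
Proof. by apply/clqP => x y; rewrite inE. Qed.

Lemma clq1 e x : clq e [set x].
Proof. by apply/clqP => y z /set1P-> /set1P->; rewrite eqxx. Qed.

Lemma om_max e S K : K \subset S -> clq e K -> #|K| <= om e S.
Proof. by move=> KS cK; apply: leq_bigmax_cond; rewrite KS. Qed.

Lemma om_attained e S : exists K, [/\ K \subset S, clq e K & #|K| = om e S].
Proof.
have [|K /andP[KS cK] Ke] := @eq_bigmax_cond _
    [pred K : {set T} | (K \subset S) && clq e K] (fun K => #|K|).
  by apply/card_gt0P; exists set0; rewrite inE sub0set clq0.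
by exists K; split=> //; rewrite -Ke; apply: eq_bigl.
Qed.

Lemma omS e S S' : S' \subset S -> om e S' <= om e S.
Proof.
move=> sS; have [K [KS cK <-]] := om_attained e S'.
exact: om_max (subset_trans KS sS) cK.
Qed.

Lemma eq_om e e' S : e =2 e' -> om e S = om e' S.
Proof.
move=> ee; apply: eq_bigl => K; congr (_ && _).
by apply/clqP/clqP => cK x y xK yK xy; [rewrite -ee|rewrite ee]; apply: cK.
Qed.

Lemma clqU1 e K y : symmetric e -> clq e K -> {in K, forall z, e y z} -> clq e (y |: K).
Proof.
move=> esym /clqP cK yK; apply/clqP => u v /setU1P[->|uK] /setU1P[->|vK].
- by rewrite eqxx.
- by move=> _; apply: yK.
- by move=> _; rewrite esym; apply: yK.
- exact: cK.
Qed.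

(** Quantifying over all colourings, not only optimal ones, expresses the bound by chi + theta
    without mentioning chromatic numbers. *)
Definition NG e := forall S k l,
  kcol e k S -> kcol (co_rel e) l S -> #|S| <= k + l.

(* [s] lists an induced pentagon in cyclic order. *)
Definition c5 e s : bool :=
  if s is [:: a; b; c; d; f] then
    [&& uniq s, e a b, e b c, e c d, e d f, e f a,
        ~~ e a c, ~~ e c f, ~~ e f b, ~~ e b d & ~~ e d a]
  else false.

Lemma co_rel_sym e : symmetric e -> symmetric (co_rel e).
Proof. by move=> esym x y; rewrite /co_rel eq_sym esym. Qed.

Lemma co_rel_irr e : irreflexive (co_rel e).
Proof. by move=> x; rewrite /co_rel eqxx. Qed.

Lemma co_relK e : irreflexive e -> co_rel (co_rel e) =2 e.
Proof.
move=> eirr x y; rewrite /co_rel; case: eqVneq => [->|_] /=; first by rewrite eirr.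
by rewrite negbK.
Qed.

Lemma NG_co e : irreflexive e -> NG e -> NG (co_rel e).
Proof.
move=> eirr ng S k l ck cl; rewrite addnC; apply: ng ck.
by rewrite -(eq_kcol _ _ (co_relK eirr)).
Qed.

(** * Minimal sets with chi above omega *)

Section MinimalImperfect.
Variables (e : rel T) (S : {set T}).
Hypotheses (esym : symmetric e) (eirr : irreflexive e).
Hypothesis Sncol : ~~ kcol e (om e S) S.
Hypothesis Smin : forall S', S' \proper S -> kcol e (om e S') S'.

(** If removing the stable set [I] lowered the clique number, minimality would colour the rest with
    fewer than [om e S] colours, and one further colour for [I] would complete a colouring of
    [S]. *)
Lemma clq_avoiding I : I \subset S -> clq (co_rel e) I ->
  exists K, [/\ K \subset S :\: I, clq e K & #|K| = om e S].
Proof.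
move=> IS /clqP cI; have [I0|[x xI]] := set_0Vmem I.
  by have := om_attained e S; rewrite I0 setD0.
have pS : S :\: I \proper S.
  apply/properP; split; first exact: subsetDl.
  by exists x; rewrite ?inE ?xI // (subsetP IS).
have [K [KS cK Ke]] := om_attained e (S :\: I).
exists K; split=> //; apply/eqP; rewrite eqn_leq Ke omS ?subsetDl //=.
rewrite leqNgt; apply: contra Sncol => lt.
have /kcolP[f [fk fP]] := Smin pS.
apply/kcolP; exists (fun x => if x \in I then om e (S :\: I) else f x); split.
  move=> y yS; case: ifPn => // yI; apply: leq_trans (fk _ _) (ltnW lt).
  by rewrite inE yI.
move=> y z yS zS eyz; case: ifPn => yI; case: ifPn => zI.
- have := cI y z yI zI; rewrite /co_rel eyz andbF.
  by case: eqVneq eyz => [->|_ _ /(_ isT)//]; rewrite eirr.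
- by rewrite gtn_eqF // fk // inE zI.
- by rewrite ltn_eqF // fk // inE yI.
- by apply: fP => //; rewrite inE ?yI ?zI.
Qed.

(** A vertex with fewer neighbours would find one of [om e S] colours free after colouring
    [S :\ x]. *)
Lemma om_le_degree x : x \in S -> om e S <= #|[set y in S | e x y]|.
Proof.
move=> xS; rewrite leqNgt; apply: contra Sncol => lt.
have /kcolP[f [fk fP]] := Smin (properD1 xS).
set N := [set y in S | e x y] in lt.
have /allPn[c] : ~~ all (mem [seq f y | y <- enum N]) (iota 0 (om e S)).
  apply: contraTN lt => /allP sub; rewrite -leqNgt.
  by have := uniq_leq_size (iota_uniq 0 (om e S)) sub; rewrite size_iota size_map cardE.
rewrite mem_iota add0n /= => cw cN.
have fw y : y \in S :\ x -> f y < om e S.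
  by move=> /fk /leq_trans; apply; apply: omS (subD1set _ _).
have nc y : y \in S -> e x y -> f y != c.
  move=> yS exy; apply: contraNneq cN => <-.
  by apply/mapP; exists y; rewrite ?mem_enum // inE yS.
apply/kcolP; exists (fun y => if y == x then c else f y); split.
  by move=> y yS; case: eqVneq => // yx; apply: fw; rewrite !inE yx.
move=> y z yS zS; case: (eqVneq y x) => [->|yx]; case: (eqVneq z x) => [->|zx] eyz.
- by rewrite eirr in eyz.
- by rewrite eq_sym nc.
- by rewrite nc // esym.
- by apply: fP; rewrite ?inE ?yx ?zx.
Qed.

Hypothesis Sng : NG e.
Hypothesis Smin' : forall S', S' \proper S -> kcol (co_rel e) (om (co_rel e) S') S'.

Lemma minimal_imperfect_c5 : exists2 s, c5 e s & {subset s <= S}.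
Proof.
set w := om e S; set a := om (co_rel e) S.
have big K : K \subset S -> clq e K -> #|K| = w.+1 -> False.
  by move=> KS cK Kw; have := om_max KS cK; rewrite Kw ltnn.
have [x xS] : exists x, x \in S.
  have [S0|[x xS]] := set_0Vmem S; last by exists x.
  case/negP: Sncol; apply/kcolP; exists (fun=> 0).
  by split=> [x|x y]; rewrite S0 inE.
(* [S] minus [x] is perfect together with its complement, so its Nordhaus-Gaddum
   sum is at most [w + a]. *)
have cardS : #|S| <= (a + w).+1.
  have := Sng (Smin (properD1 xS)) (Smin' (properD1 xS)).
  have := omS e (subD1set S x); have := omS (co_rel e) (subD1set S x).
  by rewrite (cardsD1 x S) xS -/w -/a; lia.
have [I [IS cI Ia]] := om_attained (co_rel e) S.
have [K [KSI cK Kw]] := clq_avoiding IS cI.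
have KS : K \subset S := subset_trans KSI (subsetDl _ _).
have KI z : z \in K -> z \notin I by move/(subsetP KSI); rewrite inE => /andP[].
have nI y z : y \in I -> z \in I -> ~~ e y z.
  move=> yI zI; case: (eqVneq y z) => [->|yz]; first by rewrite eirr.
  by have /clqP/(_ y z yI zI yz)/andP[] := cI.
set R := S :\: (I :|: K).
have R1 : #|R| <= 1.
  have dIK : I :&: K = set0.
    by apply/setP => z; rewrite !inE andbC; apply/negP => /andP[/KI/negP].
  have := cardsD S (I :|: K).
  rewrite (setIidPr _) ?subUset ?IS // cardsU dIK cards0 subn0 Ia Kw.
  by rewrite -/a -/w -/R; lia.
(* [y] has at least [w] neighbours, all in [K] or [R], but is not complete to [K]. *)
have attach y : y \in I -> exists2 r, r \in R & e y r.
  move=> yI; have yS := subsetP IS _ yI.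
  apply/exists_inP; apply: contraT; rewrite negb_exists_in => /forall_inP nR.
  have NK : [set z in S | e y z] \subset K.
    apply/subsetP => z; rewrite inE => /andP[zS eyz].
    apply: contraT => zK; have zI : z \notin I by apply: contraL eyz => zI; apply: nI.
    have zR : z \in R by rewrite !inE zS negb_or zI zK.
    by have := nR z zR; rewrite eyz.
  have eNK : [set z in S | e y z] = K.
    by apply/eqP; rewrite eqEcard NK Kw om_le_degree.
  case: (@big (y |: K)).
  - by rewrite subUset sub1set yS.
  - by apply: clqU1 => // z; rewrite -eNK inE => /andP[].
  - by rewrite cardsU1 Kw (contraL (@KI y)) ?yI.
have [y1 y1I] : exists y, y \in I.
  apply/card_gt0P; rewrite Ia -(cards1 x).
  by apply: om_max; rewrite ?sub1set ?clq1.
have [r rR _] := attach y1 y1I.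
have rI y : y \in I -> e y r.
  by move=> /attach[r' r'R]; have -> : r = r' by apply: (card_le1_eqP R1).
move: (rR); rewrite !inE negb_or => /andP[/andP[rnI rnK] rS].
(* The pair [r], [k] is stable, and a maximum clique avoiding it must be
   [K] with [k] exchanged for some [y] in [I]. *)
have twin k : k \in K -> ~~ e r k ->
    exists y, [/\ y \in I, ~~ e y k & {in K, forall z, z != k -> e y z}].
  move=> kK nrk; have kS := subsetP KS _ kK.
  have rk : r != k by apply: contraNneq rnK => ->.
  have [|| Q [QS /clqP cQ Qw]] := @clq_avoiding [set r; k].
  - by rewrite subUset !sub1set rS.
  - apply/clqP => u v; rewrite !inE => /orP[]/eqP-> /orP[]/eqP->; rewrite ?eqxx //.
      by rewrite /co_rel nrk => ->.
    by rewrite /co_rel esym nrk => ->.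
  have QIK z : z \in Q -> (z \in I) || (z \in K :\ k).
    move=> /(subsetP QS); rewrite !inE negb_or => /andP[/andP[zr zk] zS].
    rewrite zk /=; apply: contraT; rewrite negb_or => /andP[zI zK].
    have zR : z \in R by rewrite !inE negb_or zI zK.
    by case/eqP: zr; apply: (card_le1_eqP R1).
  (* [K :\ k] is too small to contain [Q], so [Q] meets [I], and by stability of [I] in a single
     vertex. *)
  have [y yQ yI] : exists2 y, y \in Q & y \in I.
    apply/exists_inP; apply: contraT; rewrite negb_exists_in => /forall_inP nQ.
    have /subset_leq_card : Q \subset K :\ k.
      by apply/subsetP => z zQ; have := QIK z zQ; rewrite (negPf (nQ z zQ)).
    by rewrite Qw -Kw (cardsD1 k K) kK ltnn.
  have yk : y \notin K by apply: contraL yI => /KI.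
  have eQ : Q = y |: (K :\ k).
    apply/eqP; rewrite eqEcard; apply/andP; split; last first.
      by rewrite cardsU1 !inE (negPf yk) andbF Qw -Kw (cardsD1 k K) kK.
    apply/subsetP => z zQ; rewrite in_setU1; case/orP: (QIK z zQ) => [zI|->];
      last by rewrite orbT.
    by case: eqVneq => // zy; have := cQ _ _ zQ yQ zy; rewrite (negPf (nI _ _ zI yI)).
  have yK : {in K, forall z, z != k -> e y z}.
    move=> z zK zk; apply: cQ => //; first by rewrite eQ !inE zk zK orbT.
    by apply: contraNneq yk => ->.
  exists y; split=> //; apply/negP => eyk; case: (@big (y |: K)).
  - by rewrite subUset sub1set (subsetP IS).
  - by apply: clqU1 => // z zK; case: (eqVneq z k) => [->//|]; apply: yK.
  - by rewrite cardsU1 yk Kw.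
have [k0 k0K nrk0] : exists2 k, k \in K & ~~ e r k.
  apply/exists_inP; apply: contraT; rewrite negb_exists_in => /forall_inP rK.
  case: (@big (r |: K)).
  - by rewrite subUset sub1set rS.
  - by apply: clqU1 => // z /rK; rewrite negbK.
  - by rewrite cardsU1 rnK Kw.
have [y0 [y0I ny0k0 y0K]] := twin k0 k0K nrk0.
(* Were [r] complete to [K :\ k0], then [r], [y0] and [K :\ k0] would form a clique of size
   [w.+1]. *)
have [k1 /setD1P[k10 k1K] nrk1] : exists2 k, k \in K :\ k0 & ~~ e r k.
  apply/exists_inP; apply: contraT; rewrite negb_exists_in => /forall_inP rK.
  have y0n : y0 \notin K by apply: contraL y0I => /KI.
  case: (@big (r |: (y0 |: (K :\ k0)))).
  - by rewrite !subUset !sub1set rS (subsetP IS) //= (subset_trans (subD1set _ _)).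
  - apply: clqU1 => //; first apply: clqU1 => //.
    + by apply/clqP => u v /setD1P[_ uK] /setD1P[_ vK]; have /clqP := cK; apply.
    + by move=> z /setD1P[zk zK]; apply: y0K.
    + by move=> z /setU1P[->|/rK]; rewrite ?negbK // esym rI.
  - rewrite !cardsU1 !inE (negPf y0n) (negPf rnK) !andbF orbF.
    have -> : r != y0 by apply: contraNneq rnI => ->.
    by rewrite /w -Kw (cardsD1 k0 K) k0K !add1n.
have [y2 [y2I ny2k1 y2K]] := twin k1 k1K nrk1.
have ey0k1 := y0K _ k1K k10.
have ey2k0 : e y2 k0 by apply: y2K => //; rewrite eq_sym.
have /clqP/(_ k1 k0 k1K k0K k10) ek := cK.
exists [:: r; y0; k1; k0; y2]; last first.
  move=> z; rewrite !inE => /or4P[/eqP->//|/eqP->|/eqP->|/orP[]/eqP->].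
  - exact: (subsetP IS).
  - exact: (subsetP KS).
  - exact: (subsetP KS).
  - exact: (subsetP IS).
rewrite /c5 (esym r) rI // ey0k1 ek (esym k0) ey2k0 rI // nrk1 (esym k1) ny2k1.
rewrite nI // ny0k0 (esym k0) nrk0 !andbT /= !inE !negb_or k10.
have neI z t : z \in I -> t \in K -> (z != t) && (t != z).
  move=> zI tK; rewrite eq_sym andbb; apply: contraL zI => /eqP <-; exact: KI.
have /andP[-> _] := neI _ _ y0I k0K; have /andP[-> _] := neI _ _ y0I k1K.
have /andP[_ ->] := neI _ _ y2I k0K; have /andP[_ ->] := neI _ _ y2I k1K.
have rNI z : z \in I -> r != z by move=> zI; apply: contraNneq rnI => ->.
have rNK z : z \in K -> r != z by move=> zK; apply: contraNneq rnK => ->.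
rewrite (rNI _ y0I) (rNI _ y2I) (rNK _ k0K) (rNK _ k1K) /= !andbT.
by apply: contraTneq ey0k1 => ->.
Qed.

End MinimalImperfect.

Lemma mem_pentagram s : pentagram s =i s.
Proof.
case: s => [|a [|b [|c [|d [|f []]]]]] // x; rewrite !inE.
by case: (x == a) (x == b) (x == c) (x == d) (x == f) => [] [] [] [] [].
Qed.

Lemma c5_co e s : symmetric e -> c5 e s -> c5 (co_rel e) (pentagram s).
Proof.
move=> esym; case: s => [|a [|b [|c [|d [|f []]]]]] //=; rewrite /co_rel !inE !negb_or.
case/and5P => /and5P[/and4P[ab ac ad af] /and3P[bc bd bf] /andP[cd cf] df _].
move=> eab ebc ecd /and4P[edf efa nac /and4P[ncf nfb nbd nda]].
rewrite (eq_sym c b) (eq_sym f b) (eq_sym f d) (eq_sym d a) (eq_sym d c) (eq_sym b a).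
rewrite ab ac ad af bc bd bf cd cf df nac ncf nfb nbd nda.
by rewrite (esym a f) efa (esym f d) edf (esym d c) ecd (esym c b) ebc (esym b a) eab.
Qed.

Lemma eq_c5 e e' s : e =2 e' -> c5 e s = c5 e' s.
Proof. by move=> ee; case: s => [|a [|b [|c [|d [|f []]]]]] //=; rewrite !ee. Qed.

Lemma c5_free_perfect e S : symmetric e -> irreflexive e -> NG e ->
  (forall s, {subset s <= S} -> ~~ c5 e s) -> kcol e (om e S) S.
Proof.
move=> esym eirr ng.
(* The induction treats [e] and its complement together, since the minimal case for either one uses
   colourings of smaller sets for both. *)
suff: forall n S, #|S| <= n -> (forall s, {subset s <= S} -> ~~ c5 e s) ->
    kcol e (om e S) S && kcol (co_rel e) (om (co_rel e) S) S.
  by move=> H /(H _ _ (leqnn _)) /andP[].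
elim=> [|n IH] {}S Sn noc5.
  move: Sn; rewrite leqn0 cards_eq0 => /eqP ->.
  by apply/andP; split; apply/kcolP; exists (fun=> 0); split=> [x|x y]; rewrite inE.
have Smin S' : S' \proper S ->
    kcol e (om e S') S' && kcol (co_rel e) (om (co_rel e) S') S'.
  move=> pS; apply: IH; first by rewrite -ltnS (leq_trans (proper_card pS)).
  by move=> s sS'; apply: noc5 => x /sS'; apply/subsetP/proper_sub.
apply/andP; split; apply: contraT => ncol.
  have [||s] := minimal_imperfect_c5 esym eirr ncol _ ng.
  - by move=> S' /Smin/andP[].
  - by move=> S' /Smin/andP[].
  - by move=> c5s /noc5; rewrite c5s.
have [||s] := minimal_imperfect_c5 (co_rel_sym esym) (@co_rel_irr e) ncol _ (NG_co eirr ng).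
- by move=> S' /Smin/andP[].
- by move=> S' /Smin/andP[] ? _; rewrite (eq_kcol _ _ (co_relK eirr)) (eq_om _ (co_relK eirr)).
move=> c5s sS; have := noc5 (pentagram s).
rewrite -(eq_c5 _ (co_relK eirr)) c5_co //; last exact: co_rel_sym.
by apply=> x; rewrite mem_pentagram; apply: sS.
Qed.

End Relations.

(** * Exhaustive search for pentagons *)

(* [has] and [all] with early exit also under call-by-value evaluation, where
   [||] and [&&] compute both arguments. *)
Fixpoint lhas X (p : X -> bool) (s : seq X) : bool :=
  if s is x :: s' then if p x then true else lhas p s' else false.

Fixpoint lall X (p : X -> bool) (s : seq X) : bool :=
  if s is x :: s' then if p x then lall p s' else false else true.

Lemma lhasE X (p : X -> bool) s : lhas p s = has p s.
Proof. by elim: s => //= x s ->; case: (p x). Qed.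

Lemma lallE X (p : X -> bool) s : lall p s = all p s.
Proof. by elim: s => //= x s ->; case: (p x). Qed.

(* Backtracking search for a [k]-colouring of [vs] that extends [asg] and in which
   colour [u] is the first unused one. *)
Fixpoint greedy_col (r : rel nat) k (vs : seq nat) (asg : seq (nat * nat)) u : bool :=
  if vs is v :: vs' then
    lhas (fun c =>
            if lall (fun p => if p.2 == c then ~~ r p.1 v else true) asg
            then greedy_col r k vs' ((v, c) :: asg) (maxn u c.+1) else false)
         (iota 0 (minn k u.+1))
  else true.

(** Only edges with an end in [vs] are claimed to be properly coloured, as nothing is assumed about
    the colours in [asg]. *)
Lemma greedy_col_sound r k vs asg u :
    {in vs ++ unzip1 asg &, symmetric r} -> uniq (vs ++ unzip1 asg) ->
    greedy_col r k vs asg u ->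
  exists f, [/\ {in asg, forall p, f p.1 = p.2}, {in vs, forall v, f v < k}
    & {in vs & vs ++ unzip1 asg, forall v w, v != w -> r w v -> f w != f v}].
Proof.
elim: vs asg u => [|v vs IH] asg u rsym /=.
  move=> Ua _; exists (fun a => (nth (0, 0) asg (index a (unzip1 asg))).2).
  split=> // p pa; have p1 : p.1 \in unzip1 asg by apply: map_f.
  congr (_.2); rewrite -[in RHS](nth_index (0, 0) pa); congr nth.
  rewrite -[in LHS](nth_index (0, 0) pa) -(nth_map _ 0) ?index_mem //.
  by rewrite index_uniq ?size_map ?index_mem.
move=> /andP[vn U]; rewrite lhasE => /hasP[c]; rewrite mem_iota => /andP[_ ck].
rewrite lallE; case: ifP => // /allP ok.
have pm : perm_eq (vs ++ unzip1 ((v, c) :: asg)) ((v :: vs) ++ unzip1 asg).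
  by rewrite /= -cat1s perm_catCA.
case/IH.
- by move=> x y; rewrite !(perm_mem pm); apply: rsym.
- by rewrite (perm_uniq pm) /= vn.
move=> f [fa fk fP]; exists f; have fv : f v = c := fa (v, c) (mem_head _ _).
split.
- by move=> p pa; apply: fa; rewrite inE pa orbT.
- move=> w; rewrite inE => /predU1P[->|]; last exact: fk.
  by rewrite fv (leq_trans ck) // geq_minl.
- move=> x w; rewrite inE => /predU1P[->|xvs] wv xw rwx; last first.
    by apply: fP => //; rewrite (perm_mem pm).
  move: wv; rewrite inE mem_cat eq_sym (negPf xw) /= => /orP[wvs|wa].
    rewrite eq_sym; apply: fP => //.
    - by rewrite (perm_mem pm) mem_head.
    - by rewrite eq_sym.
    - by rewrite rsym // inE ?eqxx // mem_cat wvs ?orbT.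
  have [p pa wp] := mapP wa.
  by have := ok p pa; rewrite -wp rwx; case: eqVneq => // pc _; rewrite wp fa ?fv // inE pa orbT.
Qed.

Definition rco (r : rel nat) : rel nat := fun u v => if u == v then false else ~~ r u v.

(* Sufficient for a failure of chi + theta >= size t; only the nearly balanced
   splits of [(size t).-1] are tried, which is enough for the searches below. *)
Definition violates (r : rel nat) (t : seq nat) : bool :=
  lhas (fun k => if greedy_col r k t [::] 0
                 then greedy_col (rco r) ((size t).-1 - k) t [::] 0 else false)
       (iota (size t).-1./2 (2 - odd (size t))).

Fixpoint choose k (l : seq nat) : seq (seq nat) :=
  if k is k'.+1 then
    (fix loop l := if l is x :: l' then map (cons x) (choose k' l') ++ loop l' else [::]) l
  else [:: [::]].

Lemma choose_subseq k l t : t \in choose k l -> subseq t l.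
Proof.
elim: k l t => [|k IH] l t; first by rewrite /= inE => /eqP ->; rewrite sub0seq.
elim: l => [//|x l IHl]; rewrite -[choose _ _]/(map (cons x) (choose k l) ++ choose k.+1 l).
rewrite mem_cat => /orP[/mapP[t' /IH st ->]|/IHl st].
  by rewrite /= eqxx.
exact: subseq_trans st (subseq_cons _ _).
Qed.

Definition violates_some (r : rel nat) (t0 l ks : seq nat) : bool :=
  lhas (fun k => lhas (fun t => violates r (t0 ++ t)) (choose k l)) ks.

Section ViolatesSound.
Variables (T : finType) (e : rel T).
Hypotheses (esym : symmetric e) (eirr : irreflexive e) (ng : NG e).

Lemma violates_sound (r : rel nat) (nu : nat -> T) t :
  uniq t -> t != [::] -> {in t &, injective nu} ->
  {in t &, forall u v, e (nu u) (nu v) = r u v} -> ~~ violates r t.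
Proof.
move=> Ut tn0 inj re.
have col e' r' k : symmetric e' -> {in t &, forall u v, e' (nu u) (nu v) = r' u v} ->
    greedy_col r' k t [::] 0 -> irreflexive e' -> kcol e' k [set x in map nu t].
  move=> esym' re' /greedy_col_sound; rewrite cats0 => -[||f [_ fk fP] eirr'] //.
    by move=> u v ut vt; rewrite -!re'.
  set g := fun x => f (nth 0 t (index x (map nu t))).
  have gE u : u \in t -> g (nu u) = f u.
    move=> ut; rewrite /g; congr f; apply: inj => //.
      by apply: mem_nth; rewrite -(size_map nu) index_mem map_f.
    rewrite -(nth_map _ (nu 0)) ?nth_index ?map_f //.
    by rewrite -(size_map nu) index_mem map_f.
  apply/kcolP; exists g; split.
    by move=> _ /[!inE] /mapP[u ut ->]; rewrite gE ?fk.
  move=> _ _ /[!inE] /mapP[u ut ->] /mapP[v vt ->] euv; rewrite !gE //.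
  apply: fP => //; last by rewrite -re'.
  by apply: contraTneq euv => ->; rewrite eirr'.
apply/negP; rewrite /violates lhasE => /hasP[k _]; case: ifP => // ck cl.
have c1 := col _ _ _ esym re ck eirr.
have {}cl : kcol (co_rel e) ((size t).-1 - k) [set x in map nu t].
  apply: col cl (co_rel_irr _); first exact: co_rel_sym.
  move=> u v ut vt; rewrite /co_rel /rco re // (inj_in_eq inj) //.
  by case: eqVneq.
have := ng c1 cl; rewrite cardsE (card_uniqP _) ?map_inj_in_uniq // size_map.
(* Subtraction is truncated: for larger [k] the complement would be coloured with 0 colours,
   impossible on a nonempty list. *)
case: (leqP k (size t).-1) => [kt|kt]; last first.
  case: t tn0 kt cl {Ut inj re col c1 ck} => // u t _ /= /ltnW.
  rewrite -subn_eq0 => /eqP-> /kcolP[f [fk _]] _; suff : f (nu u) < 0 by [].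
  by apply: fk; rewrite !inE eqxx.
by rewrite subnKC //; case: t tn0 {Ut inj re col cl c1 ck kt} => //= u t _; rewrite ltnn.
Qed.

Lemma violates_some_sound (r : rel nat) (nu : nat -> T) t0 l ks :
  uniq (t0 ++ l) -> t0 != [::] -> {in t0 ++ l &, injective nu} ->
  {in t0 ++ l &, forall u v, e (nu u) (nu v) = r u v} -> ~~ violates_some r t0 l ks.
Proof.
move=> U t0n inj re; rewrite /violates_some lhasE; apply/hasPn => k _.
rewrite lhasE; apply/hasPn => t /choose_subseq st.
have sub : {subset t0 ++ t <= t0 ++ l}.
  by move=> x; rewrite !mem_cat => /orP[->//|/(mem_subseq st)->]; rewrite orbT.
apply: violates_sound.
- by apply: subseq_uniq U; apply: cat_subseq.
- by case: (t0) t0n.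
- by move=> x y /sub xl /sub; apply: inj.
- by move=> x y /sub xl /sub; apply: re.
Qed.

End ViolatesSound.

(* Adjacency of the indices of a pentagon listed in cyclic order. *)
Definition pat : rel nat := fun i j => [|| j == i.+1, i == j.+1, j == i + 4 | i == j + 4].

(* A vertex relative to a base list: [inl i] is the [i]-th base vertex, [inr row]
   a vertex outside the base with its adjacencies to the base. *)
Notation code := (nat + seq bool)%type.

Definition is_new (c : code) : bool := if c is inr _ then true else false.

Definition code_adj (r : rel nat) (c : code) j : bool :=
  match c with inl i => r i j | inr row => nth false row j end.

(* Vertices below [nb] are those of the base, [nb + i] is the [i]-th vertex of a
   pentagon with codes [cs]. *)
Definition join nb (r : rel nat) (cs : seq code) : rel nat := fun u v =>
  if u < nb then
    if v < nb then r u v else code_adj r (nth (inl 0) cs (v - nb)) u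
  else if v < nb then code_adj r (nth (inl 0) cs (u - nb)) v
  else pat (u - nb) (v - nb).

(** A necessary condition for distinct vertices with these codes to have adjacency [b]. Two new
    vertices never conflict, as rows record adjacencies to the base only. *)
Definition agree (r : rel nat) (c' c : code) (b : bool) : bool :=
  match c', c with
  | inl i, inl j => if i == j then false else r i j == b
  | inl i, inr row => nth false row i == b
  | inr row, inl j => nth false row j == b
  | inr _, inr _ => true
  end.

Fixpoint compat (r : rel nat) (c : code) i q (cs : seq code) : bool :=
  if cs is c' :: cs' then
    if agree r c' c (pat q i) then compat r c i q.+1 cs' else false
  else true.

Lemma compatP r c i q cs :
  (forall j, j < size cs -> agree r (nth (inl 0) cs j) c (pat (q + j) i)) ->
  compat r c i q cs.
Proof.
elim: cs q => //= c' cs IH q H; have := H 0 isT; rewrite /= addn0 => ->.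
by apply: IH => j jlt; rewrite addSnnS; apply: (H j.+1).
Qed.

Section Explore.
Variables (r : rel nat) (codes : seq code) (cond prune fin : seq code -> bool).

(* [fin] holds of every sequence of [m] more codes that completes [cs] to a
   pentagon, all of whose prefixes satisfy [cond] and none of whose nonempty
   prefixes is discarded by [prune]. *)
Fixpoint explore m (cs : seq code) : bool :=
  if cond cs then
    if m is m'.+1 then
      lall (fun c => if compat r c (size cs) 0 cs then
                       let cs' := rcons cs c in
                       if prune cs' then true else explore m' cs'
                     else true) codes
    else fin cs
  else true.
End Explore.

(** [M] is bound outside the inner function, so that call-by-value evaluation builds the matrix once
    per relation. *)
Definition tab n (r : rel nat) : rel nat :=
  let M := map (fun u => map (r u) (iota 0 n)) (iota 0 n) in
  fun u v => nth false (nth [::] M u) v.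

Lemma tabE n r u v : u < n -> v < n -> tab n r u v = r u v.
Proof.
move=> un vn; rewrite /tab (nth_map 0) ?size_iota // (nth_map 0) ?size_iota //.
by rewrite !nth_iota.
Qed.

(** * Realizing coded pentagons in a graph *)

Section Realization.
Variables (T : finType) (e : rel T) (x0 : T).
Hypotheses (esym : symmetric e) (eirr : irreflexive e) (ng : NG e).

Definition realizes (s : seq T) (r : rel nat) :=
  uniq s /\ {in gtn (size s) &, forall i j, e (nth x0 s i) (nth x0 s j) = r i j}.

Definition code_of s z : code := if z \in s then inl (index z s) else inr (map (e z) s).

Definition place (s d : seq T) u : T :=
  if u < size s then nth x0 s u else nth x0 d (u - size s).

(* Excludes the index [nb + i] when the [i]-th coded vertex is a base vertex, as it
   would duplicate it. *)
Definition valid nb (cs : seq code) u : bool :=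
  (u < nb) || (u < nb + size cs) && is_new (nth (inl 0) cs (u - nb)).

Variables (s d : seq T) (r : rel nat).
Hypotheses (sr : realizes s r) (dpat : realizes d pat).

Lemma is_new_code z : is_new (code_of s z) = (z \notin s).
Proof. by rewrite /code_of; case: ifP. Qed.

Lemma code_adjE z j : j < size s -> e z (nth x0 s j) = code_adj r (code_of s z) j.
Proof.
move=> js; rewrite /code_of; case: ifPn => zs /=; last by rewrite (nth_map x0).
by rewrite -sr.2 ?inE ?index_mem // nth_index.
Qed.

Lemma nth_codes j : j < size d ->
  nth (inl 0) (map (code_of s) d) j = code_of s (nth x0 d j).
Proof. exact: nth_map. Qed.

Lemma place_inj : {in valid (size s) (map (code_of s) d) &, injective (place s d)}.
Proof.
move=> u v; rewrite !unfold_in /= /valid /place size_map.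
have newd w : ~~ (w < size s) ->
    (w < size s + size d) && is_new (nth (inl 0) (map (code_of s) d) (w - size s)) ->
    w - size s < size d /\ nth x0 d (w - size s) \notin s.
  move=> ws /andP[wd]; have wd' : w - size s < size d by lia.
  by rewrite nth_codes // is_new_code.
case: ifPn => us; case: ifPn => vs /=.
- by move=> _ _ /eqP; rewrite nth_uniq ?sr.1 // => /eqP.
- by move=> _ /(newd _ vs)[_ /negP vn] E; case: vn; rewrite -E mem_nth.
- by move=> /(newd _ us)[_ /negP un] _ E; case: un; rewrite E mem_nth.
move=> /(newd _ us)[ud _] /(newd _ vs)[vd _] /eqP.
by rewrite nth_uniq ?dpat.1 // => /eqP; lia.
Qed.

Lemma place_adj :
  {in valid (size s) (map (code_of s) d) &, forall u v,
    e (place s d u) (place s d v) = join (size s) r (map (code_of s) d) u v}.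
Proof.
move=> u v; rewrite !unfold_in /= /valid /place /join size_map.
have ltd w : ~~ (w < size s) -> w < size s + size d -> w - size s < size d by lia.
case: ifPn => us; case: ifPn => vs /=.
- by move=> _ _; apply: sr.2.
- by move=> _ /andP[/(ltd _ vs) vd _]; rewrite nth_codes // -code_adjE // esym.
- by move=> /andP[/(ltd _ us) ud _] _; rewrite nth_codes // -code_adjE.
- by move=> /andP[/(ltd _ us) ud _] /andP[/(ltd _ vs) vd _]; apply: dpat.2.
Qed.

(** The codes of [d] follow a branch of the search that is never cut: actual adjacencies pass
    [compat], and the last two hypotheses take care of [cond] and [prune]. *)
Lemma explore_sound (codes : seq code) (cond prune fin : pred (seq code)) n :
  explore r codes cond prune fin n [::] -> size d = n ->
  {subset map (code_of s) d <= codes} ->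
  (forall i, cond (map (code_of s) (take i d))) ->
  (forall i, ~~ prune (map (code_of s) (take i.+1 d))) ->
  fin (map (code_of s) d).
Proof.
move=> + dn; rewrite -{}dn => Ex sub condP pruneP.
suff H m : m <= size d ->
    explore r codes cond prune fin m (map (code_of s) (take (size d - m) d)) ->
    fin (map (code_of s) d).
  by apply: (H (size d)); rewrite ?subnn ?take0.
elim: m => [_|m IH md] /=; first by rewrite condP subn0 take_size.
rewrite condP lallE => /allP Hall; apply: IH; first exact: ltnW.
set i := size d - m.+1 in Hall *.
have id : i < size d by lia.
have -> : size d - m = i.+1 by lia.
have := Hall (code_of s (nth x0 d i)).
rewrite -map_rcons -(take_nth x0 id) (negPf (pruneP _)).
rewrite compatP => [|j]; first by apply; apply: sub; apply/map_f/mem_nth.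
rewrite size_map size_take id add0n => ji.
have jd := ltn_trans ji id.
rewrite map_take nth_take // nth_codes // -(dpat.2 j i) //.
rewrite /agree; case Ej: (code_of s (nth x0 d j)) => [a|row].
  move: Ej; rewrite /code_of; case: ifP => // js [<-].
  case: ifP => is_; last by rewrite (nth_map x0) ?index_mem // nth_index // esym.
  case: eqVneq => [E|_].
    have : nth x0 d j == nth x0 d i by rewrite -(nth_index x0 js) E nth_index.
    by rewrite nth_uniq ?dpat.1 // ltn_eqF.
  by rewrite -sr.2 ?inE ?index_mem // !nth_index.
case Ei: (code_of s (nth x0 d i)) => [b|//].
move: Ei; rewrite /code_of; case: ifP => // is_ [<-].
by rewrite -[nth _ row _]/(code_adj r (inr row) _) -Ej -code_adjE ?index_mem // nth_index.
Qed.

Lemma violates_join t0 l ks (cs := map (code_of s) d) :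
  uniq (t0 ++ l) -> t0 != [::] -> all (valid (size s) cs) (t0 ++ l) ->
  ~~ violates_some (tab (size s + size cs) (join (size s) r cs)) t0 l ks.
Proof.
move=> U t0n /allP V; apply: violates_some_sound U t0n _ _ => //.
  by move=> u v /V uV /V; apply: place_inj.
have lt u : valid (size s) cs u -> u < size s + size cs.
  by rewrite /valid => /orP[/ltn_addr->|/andP[]].
by move=> u v /V uV /V vV; rewrite tabE ?lt //; apply: place_adj.
Qed.

End Realization.

(** * The two finite searches *)

Fixpoint rows n : seq (seq bool) :=
  if n is n'.+1 then map (cons true) (rows n') ++ map (cons false) (rows n') else [:: [::]].

(* Binary tries, so that the bad pairs are computed only once. *)
Fixpoint table n : Type := if n is n'.+1 then (table n' * table n')%type else bool.

Fixpoint tabulate n : pred (seq bool) -> table n :=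
  match n with
  | 0 => fun f => f [::]
  | n'.+1 => fun f => (tabulate n' (fun s => f (true :: s)), tabulate n' (fun s => f (false :: s)))
  end.

Fixpoint lookup n : table n -> pred (seq bool) :=
  match n with
  | 0 => fun b _ => b
  | n'.+1 => fun t s => lookup (if head false s then t.1 else t.2) (behead s)
  end.

Lemma lookupE n f s : size s = n -> lookup (tabulate n f) s = f s.
Proof.
elim: n f s => [|n IH] f s; first by move/size0nil->.
by case: s => [//|b s] [/IH E]; case: b => /=; rewrite E.
Qed.

Definition old_codes n : seq code := map inl (iota 0 n).

(* A pentagon together with vertices 5 and 6, whose rows are the first and the
   second five bits of [s]; the last bit tells whether 5 and 6 are adjacent. *)
Definition pair_rel (s : seq bool) : rel nat := fun u v =>
  if u == v then false
  else if maxn u v < 5 then pat u v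
  else if minn u v == 5 then nth false s 10 
  else nth false s (minn u v + (if maxn u v == 5 then 0 else 5)).

(** Tries the subgraphs on six or seven vertices that contain both outside vertices. *)
Definition bad_pair (s : seq bool) : bool :=
  violates_some (tab 7 (pair_rel s)) [:: 5; 6] (iota 0 5) [:: 4; 5].

Fixpoint bad_pairs (bad : pred (seq bool)) (row : seq bool) i q (cs : seq code) : bool :=
  if cs is c :: cs' then
    if (if c is inr row' then bad (row' ++ row ++ [:: pat q i]) else false) then true
    else bad_pairs bad row i q.+1 cs'
  else false.

(** Only pairs involving the last code are tested; the other pairs were tested on shorter
    prefixes. *)
Definition prune (bad : pred (seq bool)) (cs : seq code) : bool :=
  let i := (size cs).-1 in
  if nth (inl 0) cs i is inr row then bad_pairs bad row i 0 (take i cs) else false.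

Definition three_new (cs : seq code) : bool := all is_new (take 3 cs).

(** Index 5 is the first vertex of the coded pentagon, new under [three_new]; with seven more the
    candidates have eight vertices. Old vertices of that pentagon are skipped, being listed in the
    base. *)
Definition big_violation (cs : seq code) : bool :=
  let J := tab (5 + size cs) (join 5 pat cs) in
  violates_some J [:: 5]
    ([seq 5 + i | i <- iota 0 (size cs) & (i > 0) && is_new (nth (inl 0) cs i)] ++ iota 0 5)
    [:: 7].

(** Every branch ends in a conflict with [NG], so no pentagon has its first three vertices outside
    the base. *)
Lemma three_new_search :
  explore pat (old_codes 5 ++ map inr (rows 5)) three_new
    (prune (lookup (tabulate 11 bad_pair))) big_violation 5 [::].
Proof. by vm_compute. Qed.

(* Up to rotation of both pentagons and complementation this is the only way for a
   pentagon to have exactly two vertices outside the base pentagon. *)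
Definition two_new (cs : seq code) : bool :=
  lall (fun p => p.1 p.2)
    (zip [:: is_new; is_new; fun c => ~~ is_new c; fun c => c == inl 0; fun c => ~~ is_new c] cs).

Definition code_in (js : seq nat) (c : code) : bool := if c is inl j then j \in js else false.

(* The base consists of two pentagons on [iota 0 5] and on [js]; every pentagon with
   at most two vertices outside each of them contains the base vertex [v]. *)
Definition transversal (r : rel nat) (js : seq nat) rows7 v : bool :=
  explore r (old_codes 7 ++ map inr rows7)
    (fun cs => (count (predC (code_in (iota 0 5))) cs <= 2) &&
               (count (predC (code_in js)) cs <= 2))
    xpred0 (fun cs => inl v \in cs) 5 [::].

(** The base grows by the two new vertices, numbered 5 and 6. [js] lists the three shared vertices;
    its default 0 is never reached under [two_new]. [rows7] keeps the rows of an eighth vertex that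
    create no violation on six or seven vertices. *)
Definition has_transversal (cs : seq code) : bool :=
  let js := [seq if c is inl j then j else 0 | c <- drop 2 cs] in
  let r := tab 7 (join 5 pat cs) in
  let rows7 := [seq row <- rows 7 |
     ~~ violates_some (tab 8 (join 7 r [:: inr row])) [:: 7] (iota 0 7) [:: 5; 6]] in
  lhas (transversal r [:: 5, 6 & js] rows7) js.

Lemma two_new_search :
  explore pat (old_codes 5 ++ map inr (rows 5)) two_new
    (prune (lookup (tabulate 11 bad_pair))) has_transversal 5 [::].
Proof. by vm_compute. Qed.

(** * Pentagons relative to a fixed pentagon *)

Lemma mem_rows n s : size s = n -> s \in rows n.
Proof.
elim: n s => [|n IH] s; first by move/size0nil->.
case: s => [//|b s] [/IH sn]; rewrite /= mem_cat.
by case: b; rewrite map_f ?orbT.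
Qed.

Lemma mem_old_codes n i : i < n -> inl i \in old_codes n.
Proof. by move=> lt; rewrite map_f // mem_iota. Qed.


Section C5.
Variables (T : finType) (e : rel T).
Hypotheses (esym : symmetric e) (eirr : irreflexive e).
Implicit Types C D E : seq T.

Lemma size_c5 C : c5 e C -> size C = 5.
Proof. by case: C => [|a [|b [|c [|d [|f []]]]]]. Qed.

Lemma uniq_c5 C : c5 e C -> uniq C.
Proof. by case: C => [|a [|b [|c [|d [|f []]]]]] //= /andP[]. Qed.

Lemma c5_realizes x0 C : c5 e C -> realizes e x0 C pat.
Proof.
case: C => [|a [|b [|c [|d [|f []]]]]] // c5C; split; first exact: uniq_c5 c5C.
case/and5P: c5C => _ ab bc cd /and5P[df fa /negPf ac /negPf cf].
case/and3P=> /negPf fb /negPf bd /negPf da; move=> [|[|[|[|[|//]]]]] [|[|[|[|[|//]]]]] _ _ /=;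
  by rewrite ?eirr // ?ab ?bc ?cd ?df ?fa ?ac ?cf ?fb ?bd ?da //
    esym ?ab ?bc ?cd ?df ?fa ?ac ?cf ?fb ?bd ?da.
Qed.

Lemma c5_rot i C : c5 e C -> c5 e (rot i C).
Proof.
move=> c5C; have [iC|/rot_oversize->//] := ltnP i (size C).
elim: i iC => [|i IH] iC; first by rewrite rot0.
rewrite rotS 1?ltnW //; move: (IH (ltnW iC)).
case: (rot i C) => [|a [|b [|c [|d [|f []]]]]] // h.
have := uniq_c5 h; rewrite -(rot_uniq 1) -[rot 1 _]/[:: b; c; d; f; a] => U.
rewrite /c5 U; move: h => /and5P[_ -> -> -> /and5P[-> -> ac cf /and3P[fb bd da]]].
by rewrite bd da ac cf fb.
Qed.

End C5.

Section Pairs.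
Variables (T : finType) (e : rel T).
Hypotheses (esym : symmetric e) (eirr : irreflexive e) (ng : NG e).
Implicit Types C D E : seq T.

Lemma not_bad_pair C y z : c5 e C -> y \notin C -> z \notin C -> y != z ->
  ~~ bad_pair (map (e y) C ++ map (e z) C ++ [:: e y z]).
Proof.
move=> c5C yC zC yz; rewrite /bad_pair.
have [UC adjC] := c5_realizes esym eirr y c5C; have sC := size_c5 c5C.
have lt7 u : u \in [:: 5; 6] ++ iota 0 5 -> u < 7.
  by rewrite mem_cat mem_iota !inE; lia.
apply: (@violates_some_sound _ _ esym eirr ng _ (nth y (C ++ [:: y; z]))) => //.
  move=> u v /lt7 u7 /lt7 v7 /eqP; rewrite nth_uniq ?size_cat ?sC // => [/eqP//|].
  by rewrite cat_uniq UC /= !inE (negPf yC) (negPf zC) yz.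
move=> u v /lt7 u7 /lt7 v7; rewrite tabE //.
have [/andP[u5 v5]|] := boolP ((u < 5) && (v < 5)).
  rewrite /pair_rel gtn_max u5 v5 !nth_cat sC u5 v5.
  by case: eqVneq => [->|_]; [rewrite eirr | rewrite adjC ?inE ?sC].
move: sC {UC adjC c5C yC zC}; case: C => [|a [|b [|c [|d [|f []]]]]] // _.
by move: u v u7 v7 => [|[|[|[|[|[|[|//]]]]]]] [|[|[|[|[|[|[|//]]]]]]] _ _ //= _;
  rewrite /pair_rel /= ?eirr // esym.
Qed.

Lemma bad_pairsPn bad row i q cs :
  (forall j row', j < size cs -> nth (inl 0) cs j = inr row' ->
     ~~ bad (row' ++ row ++ [:: pat (q + j) i])) ->
  ~~ bad_pairs bad row i q cs.
Proof.
elim: cs q => //= c cs IH q H; case: ifPn => [|_].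
  by case: c H => // row' /(_ 0 row' isT erefl) /negPf; rewrite addn0 => ->.
by apply: IH => j row' jlt E; rewrite addSnnS; apply: (H j.+1).
Qed.

Lemma not_prune C D bad i : c5 e C -> c5 e D ->
  (forall s, size s = 11 -> bad s = bad_pair s) ->
  ~~ prune bad (map (code_of e C) (take i.+1 D)).
Proof.
move=> c5C c5D tE; have sC := size_c5 c5C; have UD := uniq_c5 c5D.
have [x0 x0D] : exists x0, x0 \in D by case: D c5D {UD} => // x D' _; exists x; rewrite mem_head.
have [_ adjD] := c5_realizes esym eirr x0 c5D.
rewrite /prune; set cs := map _ _; set k := (size cs).-1.
have csD j : j < size cs -> j < size D /\ nth (inl 0) cs j = code_of e C (nth x0 D j).
  rewrite /cs size_map => ji; rewrite (nth_map x0) //.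
  by move: ji; rewrite size_take_min leq_min => /andP[ji jD]; rewrite nth_take.
have kcs : k < size cs by rewrite /k /cs size_map size_take (size_c5 c5D); case: ifP.
have [kD ->] := csD k kcs; rewrite {1}/code_of; case: ifP => // /negbT kC.
apply: bad_pairsPn => j row; rewrite size_take kcs => jk; rewrite nth_take //.
have [jD ->] := csD j (ltn_trans jk kcs).
rewrite /code_of; case: ifP => // /negbT jC [<-].
rewrite tE ?size_cat ?size_map ?sC // add0n -adjD // not_bad_pair //.
by rewrite nth_uniq // ltn_eqF.
Qed.

Lemma mem_codes C z : c5 e C -> code_of e C z \in old_codes 5 ++ map inr (rows 5).
Proof.
move=> /size_c5 sC; rewrite mem_cat /code_of; case: ifPn => zC.
  by rewrite mem_old_codes // -sC index_mem.
by rewrite map_f ?orbT // mem_rows // size_map.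
Qed.

Lemma not_three_new C D : c5 e C -> c5 e D -> ~~ all [predC C] (take 3 D).
Proof.
move=> c5C c5D; apply/negP => new3.
have x0 : T by case: (C) c5C => [//|x *]; exact: x.
have rC := c5_realizes esym eirr x0 c5C; have rD := c5_realizes esym eirr x0 c5D.
have sC := size_c5 c5C; have sD := size_c5 c5D.
have : big_violation (map (code_of e C) D).
  apply: (explore_sound esym rC rD three_new_search sD).
  - by move=> _ /mapP[z _ ->]; apply: mem_codes.
  - move=> i; rewrite /three_new -map_take all_map; apply/allP => z /=.
    rewrite is_new_code -take_min minnC take_min => /mem_take; exact: (allP new3).
  - by move=> i; apply: not_prune => // s; apply: lookupE.
apply/negP; rewrite /big_violation; set cs := map _ D; set L := map _ _ ++ _.
have scs : size cs = 5 by rewrite size_map.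
have UL : uniq (5 :: L).
  rewrite /= /L mem_cat mem_iota orbF; apply/andP; split.
    by apply/mapP => -[j]; rewrite mem_filter => /andP[/andP[j0 _] _]; lia.
  rewrite cat_uniq iota_uniq map_inj_uniq ?filter_uniq ?iota_uniq //; last by move=> x y; lia.
  by rewrite andbT; apply/hasPn => j; rewrite mem_iota => j5; apply/mapP => -[l _]; lia.
have := @violates_join _ _ x0 esym eirr ng C D pat rC rD [:: 5] L [:: 7] UL isT.
rewrite -/cs sC scs; apply; apply/allP => u; rewrite inE mem_cat => /or3P[/eqP->||].
- rewrite /valid scs /= /cs; case: (D) sD new3 => // d0 D' _ /andP[/= d0C _].
  by rewrite is_new_code.
- move=> /mapP[j]; rewrite mem_filter mem_iota scs => /and3P[/andP[_ jn] _ j5] ->.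
  by rewrite /valid scs addKn jn andbT ltn_add2l j5 orbT.
- by rewrite mem_iota /valid => /andP[_ ->].
Qed.

(** Two nested searches: one over the shapes of [D] relative to [C], whose outcome is a search over
    the pentagons [E] relative to the seven vertices of [C] and [D]. The hypothesis on [d3] fixes
    the rotation of [C]. *)
Lemma two_new_transversal C d0 d1 d2 d3 d4 (D := [:: d0; d1; d2; d3; d4]) :
  c5 e C -> c5 e D -> d0 \notin C -> d1 \notin C -> d2 \in C -> d3 = head d3 C -> d4 \in C ->
  exists2 v, v \in C & forall E, c5 e E ->
    count [predC C] E <= 2 -> count [predC D] E <= 2 -> v \in E.
Proof.
move=> c5C c5D n0 n1 m2 h3 m4; have x0 := d0.
have rC := c5_realizes esym eirr x0 c5C; have rD := c5_realizes esym eirr x0 c5D.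
have sC := size_c5 c5C; have sD := size_c5 c5D; have UC := uniq_c5 c5C.
have m3 : d3 \in C by rewrite h3; case: (C) sC => // c C' _; rewrite mem_head.
have i3 : code_of e C d3 = inl 0.
  by rewrite /code_of m3 h3; case: (C) sC => //= c C' _; rewrite eqxx.
set cs := map (code_of e C) D.
have : has_transversal cs.
  apply: (explore_sound esym rC rD two_new_search sD).
  - by move=> _ /mapP[z _ ->]; apply: mem_codes.
  - by move: i3 => + [|[|[|[|[|i]]]]];
      rewrite /two_new /= ?is_new_code ?n0 ?n1 ?m2 ?m4 // => ->.
  - by move=> i; apply: not_prune => // s; apply: lookupE.
pose s := C ++ [:: d0; d1].
have ss : size s = 7 by rewrite size_cat sC.
rewrite /has_transversal lhasE.
set js := [seq _ | c <- _]; set r := tab 7 _; set rows7 := filter _ _.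
have ejs : js = [:: index d2 C; 0; index d4 C].
  by rewrite /js /cs /= i3 /code_of m2 m4.
have js5 j : j \in js -> j < 5.
  by rewrite ejs !inE -sC => /or3P[]/eqP->; rewrite ?index_mem // sC.
have place_s u : u < 7 -> place x0 C D u = nth x0 s u.
  rewrite /place /s nth_cat sC => u7; case: ltnP => // u5.
  by have : u - 5 < 2 by [lia]; case: (u - 5) => [|[|k]].
have valid7 u : u < 7 -> valid (size C) cs u.
  rewrite /valid sC /cs => u7; have : (u < 5) || (u == 5) || (u == 6) by lia.
  by case/orP => [/orP[->//|/eqP->]|/eqP->]; rewrite /= is_new_code.
have rs : realizes e x0 s r.
  split.
    rewrite cat_uniq UC /= (negPf n0) (negPf n1) !inE /= andbT.
    by have /andP[] := uniq_c5 c5D; rewrite inE negb_or => /andP[].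
  move=> i j; rewrite !inE ss => i7 j7; rewrite /r tabE // -!place_s //.
  by rewrite -[5]sC; apply: place_adj => //; apply: valid7.
case/hasP => v vjs tr; exists (nth x0 s v).
  by rewrite nth_cat sC js5 // mem_nth // sC js5.
move=> E c5E nC nD; have rE := c5_realizes esym eirr x0 c5E.
have : inl v \in map (code_of e s) E.
  apply: (explore_sound esym rs rE tr (size_c5 c5E)).
  - move=> _ /mapP[z _ ->]; rewrite mem_cat /code_of; case: ifPn => zs.
      by rewrite mem_old_codes // -ss index_mem.
    apply/orP; right; apply: map_f; rewrite mem_filter mem_rows ?size_map ?ss // andbT.
    (* The one-vertex list [[:: z]] realizes [pat] trivially, so [violates_join] shows that the row
       of [z] survives the filter. *)
    have rz : realizes e x0 [:: z] pat by split=> // -[|//] [|//] _ _; rewrite /= eirr.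
    have := @violates_join _ _ x0 esym eirr ng s [:: z] r rs rz [:: 7] (iota 0 7) [:: 5; 6] isT isT.
    by rewrite ss /= /code_of (negPf zs); apply.
  (* Vertices of [A] have codes in [ks], and a prefix of [E] has no more vertices outside [A] than
     [E] has. *)
  - have cnt (A : seq T) ks i : {in A, forall z, code_in ks (code_of e s z)} ->
        count [predC A] E <= 2 -> count (predC (code_in ks)) (map (code_of e s) (take i E)) <= 2.
      move=> sub; apply: leq_trans; rewrite count_map.
      apply: leq_trans (_ : count [predC A] (take i E) <= _).
        by apply: sub_count => z /=; apply: contra => /sub.
      by rewrite -[X in _ <= count _ X](cat_take_drop i) count_cat leq_addr.
    have codeC z : z \in C -> code_of e s z = inl (index z C).
      by move=> zC; rewrite /code_of /s mem_cat zC index_cat zC.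
    have id3 : index d3 C = 0 by move: i3; rewrite /code_of m3 => -[].
    move=> i; apply/andP; split; [apply: cnt nC | apply: cnt nD] => z.
      by move=> zC; rewrite codeC // /code_in mem_iota -sC index_mem.
    rewrite !inE ejs => /or4P[/eqP->|/eqP->|/eqP->|/orP[]/eqP->];
      rewrite ?(codeC _ m2) ?(codeC _ m3) ?(codeC _ m4) /= ?inE ?eqxx ?id3 ?orbT //.
      by rewrite /code_of /s mem_cat index_cat (negPf n0) /= inE eqxx sC.
    rewrite /code_of /s mem_cat index_cat (negPf n1) /= !inE eqxx orbT sC.
    by case: ifP.
  - by [].
case/mapP => z zE; rewrite /code_of; case: ifP => // zs [->].
by rewrite nth_index.
Qed.

End Pairs.

Lemma map_pentagram X Y (f : X -> Y) s : map f (pentagram s) = pentagram (map f s).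
Proof. by case: s => [|a [|b [|c [|d [|g []]]]]]. Qed.

(** Three vertices of a 5-cycle are consecutive either on the cycle or on its pentagram. *)
Lemma three_of_five (b : seq bool) : size b = 5 -> 2 < count id b ->
  exists i, all id (take 3 (rot i b)) \/ all id (take 3 (rot i (pentagram b))).
Proof.
move=> sb cb; suff /hasP[i _ /orP] : has (fun i => all id (take 3 (rot i b)) ||
    all id (take 3 (rot i (pentagram b)))) (iota 0 5) by exists i.
by move: b sb cb => [|[] [|[] [|[] [|[] [|[] []]]]]].
Qed.

Lemma two_of_five (b : seq bool) : size b = 5 -> count id b = 2 ->
  exists i, rot i b = [:: true; true; false; false; false] \/
            rot i (pentagram b) = [:: true; true; false; false; false].
Proof.
move=> sb cb; pose t := [:: true; true; false; false; false].
suff /hasP[i _ H] : has (fun i => (rot i b == t) ||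
    (rot i (pentagram b) == t)) (iota 0 5).
  by exists i; case/orP: H => /eqP; [left | right].
by move: b sb cb => [|[] [|[] [|[] [|[] [|[] []]]]]].
Qed.

(** * A vertex common to all pentagons *)

Section Common.
Variable T : finType.
Implicit Types (e : rel T) (C D E : seq T).

(** Complementation preserves [NG] and the vertex sets of pentagons, so three new vertices may be
    assumed consecutive. *)
Lemma count_new_le2 e C D : symmetric e -> irreflexive e -> NG e ->
  c5 e C -> c5 e D -> count [predC C] D <= 2.
Proof.
move=> esym eirr ng c5C c5D; rewrite leqNgt; apply/negP => gt2.
have [||i []] := @three_of_five (map [predC C] D).
- by rewrite size_map (size_c5 c5D).
- by rewrite count_map.
- rewrite -map_rot -map_take all_map; apply/negP.
  exact: not_three_new (c5_rot i c5D).
rewrite -map_pentagram -map_rot -map_take all_map; apply/negP.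
have := not_three_new (co_rel_sym esym) (@co_rel_irr _ e) (NG_co eirr ng)
  (c5_co esym c5C) (c5_rot i (c5_co esym c5D)).
by apply: contra => /sub_all; apply=> z /=; rewrite mem_pentagram.
Qed.

Lemma transversal_rot e C D : symmetric e -> irreflexive e -> NG e ->
  c5 e C -> c5 e D -> map [predC C] D = [:: true; true; false; false; false] ->
  exists v, forall E, c5 e E -> v \in E.
Proof.
move=> esym eirr ng c5C c5D.
case: D c5D => [|d0 [|d1 [|d2 [|d3 [|d4 []]]]]] // c5D [] n0 n1 /negbFE m2 /negbFE m3 /negbFE m4.
(* The vertex [d3], opposite to the edge of new vertices in [D], is moved to the front of [C]. *)
set C' := rot (index d3 C) C.
have c5C' : c5 e C' by apply: c5_rot.
have [|||||v _ vP] := two_new_transversal esym eirr ng c5C' c5D; rewrite ?mem_rot //.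
  by rewrite /C' rot_index.
by exists v => E c5E; apply: vP => //; apply: count_new_le2 c5E.
Qed.

Lemma transversal_of_two_new e C D : symmetric e -> irreflexive e -> NG e ->
  c5 e C -> c5 e D -> count [predC C] D = 2 -> exists v, forall E, c5 e E -> v \in E.
Proof.
move=> esym eirr ng c5C c5D eq2.
have [||i [] ] := @two_of_five (map [predC C] D).
- by rewrite size_map (size_c5 c5D).
- by rewrite count_map.
- rewrite -map_rot; exact: transversal_rot (c5_rot i c5D).
rewrite -map_pentagram -map_rot => Ei.
have [|v vP] := transversal_rot (co_rel_sym esym) (@co_rel_irr _ e) (NG_co eirr ng)
  (c5_co esym c5C) (c5_rot i (c5_co esym c5D)).
  by rewrite -[RHS]Ei; apply: eq_map => z /=; rewrite mem_pentagram.
by exists v => E /(c5_co esym)/vP; rewrite mem_pentagram.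
Qed.

Lemma c5_degree e C x : symmetric e -> irreflexive e -> c5 e C -> x \in C -> count (e x) C = 2.
Proof.
move=> esym eirr; case: C => [|a [|b [|c [|d [|f []]]]]] // /and5P[_ ab bc cd].
case/and5P=> df fa /negPf ac /negPf cf /and3P[/negPf fb /negPf bd /negPf da].
by rewrite !inE => /or4P[/eqP->|/eqP->|/eqP->|/orP[]/eqP->] /=;
  rewrite !eirr ?ab ?bc ?cd ?df ?fa ?ac ?cf ?fb ?bd ?da ?(esym b a) ?(esym c b) ?(esym d c)
    ?(esym f d) ?(esym a f) ?(esym c a) ?(esym f c) ?(esym b f) ?(esym d b) ?(esym a d)
    ?ab ?bc ?cd ?df ?fa ?ac ?cf ?fb ?bd ?da.
Qed.

Lemma count_mem_eq (a : pred T) s x y :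
  count a s <= 1 -> x \in s -> y \in s -> a x -> a y -> x = y.
Proof.
move=> cs xs ys ax ay; apply/eqP; apply: contraTT cs => xy; rewrite -ltnNge.
have : uniq [:: x; y] by rewrite /= inE xy.
rewrite -size_filter => /uniq_leq_size; apply=> z.
by rewrite !inE mem_filter => /orP[]/eqP->; rewrite ?ax ?ay.
Qed.

Lemma c5_transversal e C : symmetric e -> irreflexive e -> NG e -> c5 e C ->
  exists v, forall E, c5 e E -> v \in E.
Proof.
move=> esym eirr ng c5C.
(* Pentagons are taken as 5-tuples, a finite type, to make the case distinction decidable. *)
have [/existsP[C1 /existsP[D1 /and3P[c5C1 c5D1 /eqP eq2]]]|] := boolP [exists C : 5.-tuple T,
    [exists D : 5.-tuple T, [&& c5 e C, c5 e D & count [predC C] D == 2]]].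
  exact: transversal_of_two_new eq2.
rewrite negb_exists => /forallP noC.
have le1 C' D' : c5 e C' -> c5 e D' -> count [predC C'] D' <= 1.
  move=> c5C' c5D'; have := count_new_le2 esym eirr ng c5C' c5D'.
  have sC : size C' == 5 by rewrite (size_c5 c5C').
  have sD : size D' == 5 by rewrite (size_c5 c5D').
  have := noC (Tuple sC); rewrite negb_exists => /forallP/(_ (Tuple sD)) /=.
  by rewrite c5C' c5D' /=; case: (count _ _) => [|[|[|]]].
have [/existsP[D1 /andP[c5D1 /hasP[d0 d0D d0C]]]|] := boolP [exists D : 5.-tuple T,
    c5 e D && has [predC C] D]; last first.
  (* If no pentagon leaves [C], all have the vertex set of [C], and any vertex of [C] will do. *)
  rewrite negb_exists => /forallP noD.
  case: C c5C {noC} noD => // x C c5C noD; exists x => E c5E.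
  have sE : size E == 5 by rewrite (size_c5 c5E).
  have := noD (Tuple sE); rewrite c5E /= -all_predC => /allP EC.
  have sub : {subset E <= x :: C} by move=> z /EC /=; rewrite negbK.
  have [|_ ->] := uniq_min_size (uniq_c5 c5E) sub; last by rewrite mem_head.
  by rewrite (size_c5 c5C) (size_c5 c5E).
have := c5_rot (index d0 D1) c5D1; rewrite rot_index //.
case: (_ ++ _) => [|d1 [|d2 [|d3 [|d4 []]]]] // c5D.
exists d1 => E c5E; apply: contraT => d1E.
set D := [:: d0; d1; d2; d3; d4] in c5D.
(* The twin [d0] of [C] and [D], and the vertex [c] it replaces, are both adjacent to
   [d4]; if [d1] is not in [E], then [E] contains [d0], [c] and [d3], all adjacent
   to [d4]. *)
have inC z : z \in D -> z != d0 -> z \in C.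
  move=> zD; apply: contraNT => zC; apply/eqP.
  by apply: count_mem_eq (le1 _ _ c5C c5D) zD _ zC d0C; rewrite mem_head.
have := uniq_c5 c5D; rewrite /= !inE !negb_or => /and5P[/and4P[d01 _ d03 d04]].
move=> /and3P[_ d13 d14] _ _ _.
have d1C : d1 \in C by rewrite inC ?inE ?eqxx ?orbT // eq_sym.
have d4C : d4 \in C by rewrite inC ?inE ?eqxx ?orbT // eq_sym.
have CE z : z \in C -> z != d1 -> z \in E.
  move=> zC; apply: contraNT => zE; apply/eqP.
  exact: count_mem_eq (le1 _ _ c5E c5C) zC d1C zE d1E.
have DE z : z \in D -> z != d1 -> z \in E.
  move=> zD; apply: contraNT => zE; apply/eqP.
  by apply: count_mem_eq (le1 _ _ c5E c5D) zD _ zE d1E; rewrite !inE eqxx orbT.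
move: (c5D) => /and5P[_ e01 e12 e23 /and5P[e34 e40 _ _ /and3P[/negPf e41 _ _]]].
(* [d4] has two neighbours in [C]; [c] is one other than [d3]. *)
have [c cC /andP[e4c cd3]] : exists2 c, c \in C & e d4 c && (c != d3).
  apply/hasP; apply: contraT => /hasPn no.
  have : {subset filter (e d4) C <= [:: d3]}.
    by move=> z; rewrite mem_filter inE => /andP[e4z /no]; rewrite e4z negbK.
  move=> /(uniq_leq_size (filter_uniq _ (uniq_c5 c5C))).
  by rewrite size_filter (c5_degree esym eirr c5C d4C).
have cE : c \in E by apply: CE => //; apply: contraTneq e4c => ->; rewrite e41.
have d4E : d4 \in E by rewrite DE ?inE ?eqxx ?orbT // eq_sym.
have : {subset [:: d0; d3; c] <= filter (e d4) E}.
  move=> z; rewrite !inE mem_filter => /or3P[]/eqP->.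
  - by rewrite e40 DE ?inE ?eqxx.
  - by rewrite esym e34 DE ?inE ?eqxx ?orbT // eq_sym.
  - by rewrite e4c.
(* Three neighbours of [d4] in [E] contradict its degree two there; [c] differs from [d0] because
   [d0] is not in [C]. *)
move=> /uniq_leq_size; rewrite size_filter (c5_degree esym eirr c5E d4E) /= !inE; apply.
rewrite negb_or d03 (eq_sym d3) cd3 !andbT.
by apply: contraNneq d0C => ->.
Qed.

End Common.

(** * Transfer to graphs *)

(** Colourings of [S] are pushed forward to its image under [h], which has the same size. *)
Lemma NG_pullback (T T' : finType) (e : rel T) (e' : rel T') (h : T' -> T) :
  injective h -> (forall x y, e' x y = e (h x) (h y)) -> NG e -> NG e'.
Proof.
move=> hinj ee ng S k l ck cl.
have push (r : rel T) (r' : rel T') j : (forall x y, r' x y = r (h x) (h y)) ->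
    kcol r' j S -> kcol r j (h @: S).
  move=> rr /kcolP[f [fk fP]]; apply/kcolP.
  pose g y := if [pick x | h x == y] is Some x then f x else 0.
  have gh x : g (h x) = f x.
    by rewrite /g; case: pickP => [z /eqP/hinj->//|/(_ x)]; rewrite eqxx.
  exists g; split; first by move=> _ /imsetP[x xS ->]; rewrite gh fk.
  by move=> _ _ /imsetP[x xS ->] /imsetP[y yS ->]; rewrite -rr !gh; apply: fP.
rewrite -(card_imset _ hinj); apply: ng; first exact: push ck.
by apply: push cl => x y; rewrite /co_rel ee (inj_eq hinj).
Qed.

Lemma c5_image (T T' : finType) (e : rel T) (e' : rel T') (h : T' -> T) s :
  injective h -> (forall x y, e' x y = e (h x) (h y)) -> c5 e' s -> c5 e (map h s).
Proof.
move=> hinj ee; case: s => [|a [|b [|c [|d [|f []]]]]] // /andP[U].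
by rewrite !ee => H; apply/andP; split; first rewrite -(map_inj_uniq hinj) in U.
Qed.

Lemma chi_le (K : sgraph) k : colorable K k -> chi K <= k.
Proof. by rewrite /chi; case: ex_minnP => m _; apply. Qed.

Lemma colorable_chi (K : sgraph) : colorable K (chi K).
Proof. by rewrite /chi; case: ex_minnP. Qed.

Lemma kcol_colorable (T : finType) (e : rel T) (S : {set T}) k (K : sgraph) (h : K -> T) :
  (forall x, h x \in S) -> (forall x y, adj x y -> e (h x) (h y)) ->
  kcol e k S -> colorable K k.
Proof.
move=> hS he /kcolP[f [fk fP]]; apply/existsP.
exists [ffun x => Ordinal (fk _ (hS x))].
apply/forallP => x; apply/forallP => y; apply/implyP => /he exy.
by rewrite !ffunE -val_eqE; apply: fP (hS _) (hS _) exy.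
Qed.

Lemma one_HNG_NG (G : sgraph) : one_HNG G -> NG (@adj G).
Proof.
move=> hG S k l ck cl; have [->|Sn0] := eqVneq S set0; first by rewrite cards0.
have := hG S Sn0; rewrite {1}/induced /= card_sig (eq_card (B := S)) // => /leq_trans; apply.
apply: leq_add; apply: chi_le.
  by apply: (@kcol_colorable _ _ _ _ (induced S) val _ _ ck) => // x; exact: valP.
apply: (@kcol_colorable _ _ _ _ (compl (induced S)) val _ _ cl); first by move=> x; exact: valP.
by move=> x y; rewrite /= /compl_adj /co_rel val_eqE.
Qed.

Lemma omegaE (K : sgraph) : omega K = om (@adj K) setT.
Proof. by apply: eq_bigl => A; rewrite subsetT. Qed.

(** A proper colouring is injective on a maximum clique. *)
Lemma omega_le_chi (K : sgraph) : omega K <= chi K.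
Proof.
rewrite omegaE; have [Q [_ /clqP cQ <-]] := om_attained (@adj K) setT.
have /existsP[f /forallP fP] := colorable_chi K.
rewrite -[chi K]card_ord -(card_in_imset (f := f)) ?max_card // => x y xQ yQ.
apply: contra_eq => xy; have /forallP/(_ y)/implyP := fP x; apply.
exact: cQ.
Qed.

(** An induced subgraph of [induced S] embeds in [G] by applying [val] twice; this carries [NG] down
    and pentagons up. *)
Lemma induced_perfect (G : sgraph) (S : {set G}) : NG (@adj G) ->
  (forall s, c5 (@adj G) s -> ~~ all (mem S) s) -> perfect (induced S).
Proof.
move=> ng noc5 S' _; set K := induced S'.
pose h (x : K) : G := val (val x).
have hinj : injective h by move=> x y /val_inj/val_inj.
have hS x : h x \in S := valP (val x).
apply/eqP; rewrite eqn_leq omega_le_chi andbT omegaE; apply: chi_le.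
apply: (kcol_colorable (e := @adj K) (S := setT) (h := id)) => //.
apply: c5_free_perfect.
- exact: adj_sym.
- exact: adj_irrefl.
- exact: (NG_pullback hinj _ ng).
- move=> s _; apply/negP => /(c5_image (e := @adj G) hinj (fun _ _ => erefl)) /noc5.
  by case/allP=> _ /mapP[x _ ->]; apply: hS.
Qed.

Theorem theorem4p1 (G : sgraph) (G_nonempty : 0 < #|G|) (hG : one_HNG G) :
  exists v : G, perfect (del_vertex v).
Proof.
have ng := one_HNG_NG hG.
have [/existsP[C c5C]|noC] := boolP [exists C : 5.-tuple G, c5 (@adj G) C].
  have [v vP] := c5_transversal (@adj_sym G) (@adj_irrefl G) ng c5C.
  exists v; apply: induced_perfect => // s /vP vs.
  by apply/allPn; exists v => //=; rewrite !inE eqxx.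
(* Without pentagons any vertex will do. *)
have [v _] := card_gt0P G_nonempty; exists v.
apply: induced_perfect => // s c5s; case/negP: noC; apply/existsP.
have ss : size s == 5 by rewrite (size_c5 c5s).
by exists (Tuple ss).
Qed.
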